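(* Let $w_X,w_Y,w_Z,w_\kappa,w_\lambda,w_\mu\in\mathbb N$. For each $n\in\mathbb N$ let $\mathfrak{BI}_n$ denote the $\mathbb F$-subspace of $\mathfrak{BI}$ spanned by $X^iY^jZ^k\kappa^r\lambda^s\mu^t$ for all $i,j,k,r,s,t\in\mathbb N$ with $$w_Xi+w_Yj+w_Zk+w_\kappa r+w_\lambda s+w_\mu t\leq n.$$ Then $\{\mathfrak{BI}_n\}_{n\in\mathbb N}$ is an $\mathbb N$-filtration of $\mathfrak{BI}$ if and only if $$\max\{w_Z,w_\kappa\}\leq w_X+w_Y,\qquad \max\{w_X,w_\lambda\}\leq w_Y+w_Z,\qquad \max\{w_Y,w_\mu\}\leq w_Z+w_X.$$
   Context: $\mathbb F$ is a field with $\operatorname{char}\mathbb F\neq 2$; $\mathbb N$ is the set of nonnegative integers. Algebras are associative with unit $1$. $\{a,b\}=ab+ba$. The Bannai--Ito algebra $\mathfrak{BI}$ is the $\mathbb F$-algebra defined by generators $X,Y,Z$ and the relations asserting that each of $\kappa=\{X,Y\}-Z$, $\lambda=\{Y,Z\}-X$, $\mu=\{Z,X\}-Y$ is central in $\mathfrak{BI}$. For $\mathbb F$-subspaces $\mathcal H,\mathcal K$ of an $\mathbb F$-algebra $\mathcal A$, $\mathcal H\cdot\mathcal K$ is the $\mathbb F$-subspace spanned by all products $h\cdot k$ with $h\in\mathcal H$, $k\in\mathcal K$. An $\mathbb N$-filtration of $\mathcal A$ is a sequence $\{\mathcal A_n\}_{n\in\mathbb N}$ of $\mathbb F$-subspaces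 of $\mathcal A$ such that $\bigcup_{n\in\mathbb N}\mathcal A_n=\mathcal A$; $\mathcal A_n\subseteq\mathcal A_{n+1}$ for all $n\in\mathbb N$; and $\mathcal A_m\cdot\mathcal A_n\subseteq\mathcal A_{m+n}$ for all $m,n\in\mathbb N$. *)

(* Defs.v *)
From HB Require Import structures.
From mathcomp Require Import all_boot all_algebra.
From mathcomp Require Import generic_quotient ring_quotient.
From mathcomp Require Import finmap boolp classical_sets.
From mathcomp.multinomials Require Import monalg.

Set Implicit Arguments.
Unset Strict Implicit.
Unset Printing Implicit Defensive.

Import GRing.Theory.
Local Open Scope classical_set_scope.
Local Open Scope quotient_scope.
Local Open Scope ring_scope.

Section MonoidAlgebra.
Variables (R : comNzRingType) (K : monomType).

Fact malg_scalerAr (c : R) (u v : {malg R[K]}) : c *: (u * v) = u * (c *: v).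
Proof.
apply/malgP => k; rewrite mcoeffZ (mcoeffMl u v).
rewrite (mcoeffMlw k (fsubset_refl (msupp u)) (msuppZ_le c v)).
rewrite mulr_sumr; apply: eq_bigr => k1 _; rewrite mulr_sumr.
by apply: eq_bigr => k2 _; rewrite mcoeffZ mulrCA mulrnAr.
Qed.

Fact mcoeff1M (u v : {malg R[K]}) :
  mcoeff mone (u * v) = mcoeff mone u * mcoeff mone v.
Proof. exact: (rmorphM (@mcoeff K R mone)). Qed.

Fact mcoeff1_comm (u v : {malg R[K]}) : mcoeff mone (u * v - v * u) = 0.
Proof.
have := raddfB (@mcoeff K R mone) (u * v) (v * u) => /= ->.
by rewrite !mcoeff1M mulrC subrr.
Qed.

End MonoidAlgebra.

Section FreeAlgebra.
Variables (R : comNzRingType) (I : choiceType).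

(* The free associative unital algebra is the monoid algebra of the free
   (noncommutative) monoid on I *)
Definition free_alg := {malg R[{fmonom I}]}.

HB.instance Definition _ := GRing.Lalgebra.on free_alg.

HB.instance Definition _ := GRing.Lalgebra_isAlgebra.Build R free_alg
  (@malg_scalerAr R {fmonom I}).

End FreeAlgebra.

HB.lock Definition free_gen (R : comNzRingType) (I : choiceType) (i : I) :
  free_alg R I := << fmu i >>.

Definition two_sided_ideal (A : pzRingType) (J : set A) : Prop :=
  [/\ J 0, forall u v, J u -> J v -> J (u - v),
      forall a u, J u -> J (a * u) & forall a u, J u -> J (u * a)].

Definition ideal_span (A : pzRingType) (S : set A) : set A :=
  smallest (@two_sided_ideal A) S.

Fact ideal_span_ideal (A : pzRingType) (S : set A) :
  two_sided_ideal (ideal_span S).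
Proof.
split=> [J [[]]|u v Ju Jv J CJ|a u Ju J CJ|a u Ju J CJ] //;
  have [[J0 JB JMl JMr] SJ] := CJ; [apply: JB|apply: JMl|apply: JMr];
  by [apply: Ju|apply: Jv].
Qed.

Section Presentation.
Variables (R : comNzRingType) (I : choiceType) (rel : set (free_alg R I)).

Definition relP : {pred free_alg R I} := fun u => `[< ideal_span rel u >].

Fact relP_zmod_closed : zmod_closed relP.
Proof.
have [J0 JB _ _] := ideal_span_ideal rel.
by split=> [|u v /asboolP Ju /asboolP Jv]; apply/asboolP; [|apply: JB].
Qed.

HB.instance Definition _ :=
  GRing.isZmodClosed.Build (free_alg R I) relP relP_zmod_closed.

Definition presented := Quotient.quot relP.

HB.instance Definition _ := GRing.Zmodule.on presented.
HB.instance Definition _ := EqQuotient.on presented.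

End Presentation.

(* The structure maps are sealed because conversion on representatives of
   classes is intractable *)
HB.lock Definition pres_proj (R : comNzRingType) (I : choiceType)
    (rel : set (free_alg R I)) (u : free_alg R I) : presented rel :=
  \pi_(presented rel) u.

HB.lock Definition pres_mul (R : comNzRingType) (I : choiceType)
    (rel : set (free_alg R I)) (x y : presented rel) : presented rel :=
  pres_proj rel (repr x * repr y).

HB.lock Definition pres_scale (R : comNzRingType) (I : choiceType)
    (rel : set (free_alg R I)) (c : R) (x : presented rel) : presented rel :=
  pres_proj rel (c *: repr x).

Section PresentationTheory.
Variables (R : comNzRingType) (I : choiceType) (rel : set (free_alg R I)).
Local Notation presented := (presented rel).
Local Notation pres_proj := (@pres_proj R I rel).
Local Notation pres_mul := (@pres_mul R I rel).
Local Notation pres_scale := (@pres_scale R I rel).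

Definition pres_one : presented := pres_proj 1.

Lemma pres_projE u v : pres_proj u = pres_proj v <-> ideal_span rel (u - v).
Proof.
rewrite pres_proj.unlock; split=> [/eqP|H].
  by rewrite -Quotient.idealrBE => /asboolP.
by apply/eqP; rewrite -Quotient.idealrBE; apply/asboolP.
Qed.

Lemma pres_projK (x : presented) : pres_proj (repr x) = x.
Proof. by rewrite pres_proj.unlock reprK. Qed.

Lemma pres_projD : {morph pres_proj : u v / u + v}.
Proof. by move=> u v; rewrite pres_proj.unlock piE. Qed.

Let J := ideal_span_ideal rel.

Lemma pres_projM u v : pres_proj (u * v) = pres_mul (pres_proj u) (pres_proj v).
Proof.
have [J0 JB JMl JMr] := J.
have JD a b : ideal_span rel a -> ideal_span rel b -> ideal_span rel (a + b).
  by move=> Ja Jb; rewrite -[b]opprK; apply: (JB) => //; rewrite -sub0r; apply: JB.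
rewrite pres_mul.unlock; apply/pres_projE; set u' := repr _; set v' := repr _.
have Ju : ideal_span rel (u - u') by apply/pres_projE; rewrite pres_projK.
have Jv : ideal_span rel (v - v') by apply/pres_projE; rewrite pres_projK.
have -> : u * v - u' * v' = (u - u') * v + u' * (v - v').
  by rewrite mulrBl mulrBr addrA subrK.
by apply: JD; [apply: JMr|apply: JMl].
Qed.

Lemma pres_projZ c u : pres_proj (c *: u) = pres_scale c (pres_proj u).
Proof.
have [_ _ JMl _] := J; rewrite pres_scale.unlock; apply/pres_projE; rewrite -scalerBr.
rewrite -[X in _ *: X]mul1r scalerAl; apply: JMl.
by apply/pres_projE; rewrite pres_projK.
Qed.

Fact pres_mulA : associative pres_mul.
Proof.
move=> x y z; rewrite -(pres_projK x) -(pres_projK y) -(pres_projK z).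
by rewrite -!pres_projM mulrA.
Qed.

Fact pres_mul1 : left_id pres_one pres_mul.
Proof. by move=> x; rewrite -(pres_projK x) -pres_projM mul1r. Qed.

Fact pres_mulr1 : right_id pres_one pres_mul.
Proof. by move=> x; rewrite -(pres_projK x) -pres_projM mulr1. Qed.

Fact pres_mulDl : left_distributive pres_mul +%R.
Proof.
move=> x y z; rewrite -(pres_projK x) -(pres_projK y) -(pres_projK z).
by rewrite -pres_projD -!pres_projM -pres_projD mulrDl.
Qed.

Fact pres_mulDr : right_distributive pres_mul +%R.
Proof.
move=> x y z; rewrite -(pres_projK x) -(pres_projK y) -(pres_projK z).
by rewrite -pres_projD -!pres_projM -pres_projD mulrDr.
Qed.

Fact pres_scaleAl c x y :
  pres_scale c (pres_mul x y) = pres_mul (pres_scale c x) y.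
Proof.
rewrite -(pres_projK x) -(pres_projK y).
by rewrite -pres_projM -!pres_projZ -pres_projM scalerAl.
Qed.

Fact pres_scaleAr c x y :
  pres_scale c (pres_mul x y) = pres_mul x (pres_scale c y).
Proof.
rewrite -(pres_projK x) -(pres_projK y).
by rewrite -pres_projM -!pres_projZ -pres_projM scalerAr.
Qed.

HB.instance Definition _ := GRing.Zmodule_isPzRing.Build presented
  pres_mulA pres_mul1 pres_mulr1 pres_mulDl pres_mulDr.

Fact pres_scaleA a b x : pres_scale a (pres_scale b x) = pres_scale (a * b) x.
Proof. by rewrite -(pres_projK x) -!pres_projZ scalerA. Qed.

Fact pres_scale1 : left_id 1 pres_scale.
Proof. by move=> x; rewrite -(pres_projK x) -pres_projZ scale1r. Qed.

Fact pres_scaleDr : right_distributive pres_scale +%R.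
Proof.
move=> c x y; rewrite -(pres_projK x) -(pres_projK y) -pres_projD.
by rewrite -!pres_projZ -pres_projD scalerDr.
Qed.

Fact pres_scaleDl x : {morph pres_scale^~ x : a b / a + b}.
Proof.
by move=> a b; rewrite -(pres_projK x) -!pres_projZ -pres_projD scalerDl.
Qed.

HB.instance Definition _ := GRing.Zmodule_isLmodule.Build R presented
  pres_scaleA pres_scale1 pres_scaleDr pres_scaleDl.

Fact pres_proj_monoid_morphism : monoid_morphism pres_proj.
Proof. by split=> // u v; exact: pres_projM. Qed.

Fact pres_proj_linear : linear pres_proj.
Proof.
by move=> c u v; rewrite pres_projD; congr (_ + _); exact: pres_projZ.
Qed.

HB.instance Definition _ :=
  GRing.isLinear.Build R (free_alg R I) presented _ pres_proj pres_proj_linear.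
HB.instance Definition _ :=
  GRing.isMonoidMorphism.Build (free_alg R I) presented pres_proj
    pres_proj_monoid_morphism.

Fact pres_oner_neq0 : ~ ideal_span rel 1 -> pres_one != 0.
Proof.
move=> J1; apply/eqP => E; apply: J1; rewrite -(subr0 1); apply/pres_projE.
by rewrite raddf0.
Qed.

Definition pres_gen (i : I) : presented := pres_proj (free_gen R i).

End PresentationTheory.

Definition anticomm (A : pzRingType) (a b : A) : A := a * b + b * a.

Section BannaiIto.
Variable F : fieldType.

Definition iX : 'I_3 := @Ordinal 3 0 isT.
Definition iY : 'I_3 := @Ordinal 3 1 isT.
Definition iZ : 'I_3 := @Ordinal 3 2 isT.

Definition bi_central : seq (free_alg F 'I_3) :=
  let x := free_gen F iX in let y := free_gen F iY in let z := free_gen F iZ in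
  [:: anticomm x y - z; anticomm y z - x; anticomm z x - y].

Definition bi_rel : set (free_alg F 'I_3) :=
  [set c * u - u * c | c in [set` bi_central] & u in setT].

Definition BI : Type := presented bi_rel.

HB.instance Definition _ := GRing.Lmodule.on BI.
HB.instance Definition _ := GRing.PzRing.on BI.

(* The constant coefficient is a character of the free algebra that kills
   every commutator, so 1 is not in the ideal of relations *)
Fact bi_rel_proper : ~ ideal_span bi_rel 1.
Proof.
move=> /(_ [set u : free_alg F 'I_3 |
  @mcoeff {fmonom 'I_3} F mone u = 0]) /= J1.
have : @mcoeff {fmonom 'I_3} F mone 1 = 0.
  apply: J1; split=> [|_ [c _ [u _ <-]]] /=; last first.
    exact: mcoeff1_comm.
  split=> /= [|u v u0 v0|a u u0|a u u0]; first by rewrite mcoeff0.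
  - by rewrite mcoeffB u0 v0 subrr.
  - by rewrite mcoeff1M u0 mulr0.
  - by rewrite mcoeff1M u0 mul0r.
by move/eqP; rewrite rmorph1 oner_eq0.
Qed.

HB.instance Definition _ :=
  GRing.PzSemiRing_isNonZero.Build BI (pres_oner_neq0 bi_rel_proper).
HB.instance Definition _ :=
  GRing.LSemiModule_isLSemiAlgebra.Build F BI (@pres_scaleAl _ _ bi_rel).
HB.instance Definition _ :=
  GRing.LSemiAlgebra_isSemiAlgebra.Build F BI (@pres_scaleAr _ _ bi_rel).

Definition bi_X : BI := pres_gen bi_rel iX.
Definition bi_Y : BI := pres_gen bi_rel iY.
Definition bi_Z : BI := pres_gen bi_rel iZ.

Definition bi_kappa : BI := anticomm bi_X bi_Y - bi_Z.
Definition bi_lambda : BI := anticomm bi_Y bi_Z - bi_X.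
Definition bi_mu : BI := anticomm bi_Z bi_X - bi_Y.

End BannaiIto.

Arguments bi_rel F : clear implicits.

Section Filtration.
Variable F : fieldType.

Definition subspace (V : lmodType F) (S : set V) : Prop :=
  submod_closed [in S].

Definition lspan (V : lmodType F) (S : set V) : set V :=
  smallest (@subspace V) S.

Definition subspace_mul (A : algType F) (H K : set A) : set A :=
  lspan [set h * k | h in H & k in K].

Definition nat_filtration (A : algType F) (S : nat -> set A) : Prop :=
  [/\ forall n, subspace (S n),
      \bigcup_n S n = setT,
      forall n, S n `<=` S n.+1
    & forall m n, subspace_mul (S m) (S n) `<=` S (m + n)%N].

Definition BI_n (wX wY wZ wk wl wm n : nat) : set (BI F) :=
  lspan [set v | exists i j k r s t : nat,
    (wX * i + wY * j + wZ * k + wk * r + wl * s + wm * t <= n)%N /\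
    v = bi_X F ^+ i * bi_Y F ^+ j * bi_Z F ^+ k *
        bi_kappa F ^+ r * bi_lambda F ^+ s * bi_mu F ^+ t].

End Filtration.

Arguments BI_n F wX wY wZ wk wl wm n : clear implicits.

(* Main.v *)
From HB Require Import structures.
Require Import Defs.
From mathcomp Require Import all_boot all_algebra.
From mathcomp Require Import boolp classical_sets.
From mathcomp Require Import finmap functions.
From mathcomp Require Import ring zify.
From mathcomp.multinomials Require Import monalg.

Set Implicit Arguments.
Unset Strict Implicit.
Unset Printing Implicit Defensive.

Import GRing.Theory.
Local Open Scope ring_scope.

(** If the weights satisfy the inequalities, then each of the straightening
    rules Y X = Z + kappa - X Y, Z Y = X + lambda - Y Z, Z X = Y + mu - X Z does
    not increase weight, so left multiplication by a generator raises the
    weight of a normally ordered monomial by at most its own weight.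

    Conversely, in a filtration {X,Y} = Z + kappa has weight at most wX + wY. If
    wZ (resp. w_kappa) were larger, then Z + kappa would be a combination of
    monomials without Z (resp. without kappa). This is refuted by functionals
    on BI: for arbitrary kappa, lambda, mu, zeta in F[T] there is a
    BI-module of functions N^2 -> F[T], coinduced from the character
    X |-> zeta, in which X^i Y^j Z^k kappa^r lambda^s mu^t f takes the value
    zeta^i kappa^r lambda^s mu^t f(j,k) at (0,0). The coefficient of T in this
    value, for suitable parameters and f, kills all the monomials
    allowed but not Z + kappa. The other two pairs of inequalities are obtained
    in the same way. *)

(** * Actions of presented algebras *)

(** Every element is a finite combination of words, and a word arises from [1] by prepending
    letters. *)
Lemma free_alg_ind (R : comNzRingType) (I : choiceType)
    (P : free_alg R I -> Prop) :
    (forall c u v, P u -> P v -> P (c *: u + v)) -> P 1 ->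
    (forall i u, P u -> P (free_gen R i * u)) ->
  forall u, P u.
Proof.
move=> PL P1 PM u.
have P0 : P 0 by rewrite -(addNr 1) -scaleN1r; apply: PL.
have PU (s : seq I) : P (mkmalgU (FMonom s) 1).
  elim: s => [|i s IH]; first by rewrite -fmoneE.
  have -> : mkmalgU (FMonom (i :: s)) 1 =
      free_gen R i * mkmalgU (FMonom s) 1 :> free_alg R I.
    by rewrite free_gen.unlock [RHS]fgmulUU mulr1 fmuE /= [mmul _ _]fmmulE.
  exact: PM.
rewrite (monalgE u); elim/big_ind: _ => // [v w Pv Pw|k _].
  by rewrite -[v]scale1r; apply: PL.
rewrite -[<< _ *g _ >>]addr0; have -> : << u@_k *g k >> = u@_k *: << k >>.
  apply/malgP => l; rewrite mcoeffZ [LHS]mcoeffU [X in _ * X]mcoeffU.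
  by rewrite mulrnAr mulr1.
by apply: PL => //; rewrite -(fmK k); apply: PU.
Qed.

Lemma presented_ind (R : comNzRingType) (I : choiceType)
    (rel : set (free_alg R I)) (P : presented rel -> Prop) :
    (forall c x y, P x -> P y -> P (c *: x + y)) -> P 1 ->
    (forall i x, P x -> P (pres_gen rel i * x)) ->
  forall x, P x.
Proof.
move=> PL P1 PM x; rewrite -(pres_projK x).
elim/free_alg_ind: (repr x) => [c u v Pu Pv||i u Pu].
- by rewrite linearP; apply: PL.
- exact: P1.
- by rewrite rmorphM; apply: PM.
Qed.

Lemma pres_proj_anticomm (R : comNzRingType) (I : choiceType)
    (rel : set (free_alg R I)) i1 i2 i3 :
  pres_proj rel (anticomm (free_gen R i1) (free_gen R i2) - free_gen R i3) =
  anticomm (pres_gen rel i1) (pres_gen rel i2) - pres_gen rel i3.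
Proof.
rewrite /anticomm [LHS]raddfB [X in X - _]raddfD.
by rewrite [X in X + _ - _]pres_projM [X in _ + X - _]pres_projM.
Qed.

Section WordAction.
Variables (R : comNzRingType) (I : choiceType) (V : lmodType R)
  (T : I -> V -> V).
Hypothesis T_linear : forall i, linear (T i).

(** The leftmost letter of a word acts last, which makes this a left action. *)
Definition free_act (u : free_alg R I) (v : V) : V :=
  \sum_(m <- msupp u) u@_m *: foldr T v (m : seq I).

Lemma free_actEw (d : {fset {fmonom I}}) u v : (msupp u `<=` d)%fset ->
  free_act u v = \sum_(m <- d) u@_m *: foldr T v (m : seq I).
Proof.
move=> ud; rewrite /free_act (big_fset_incl _ ud) //= => m _ /mcoeff_outdom ->.
by rewrite scale0r.
Qed.

Lemma free_act_linearl v : linear (free_act^~ v).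
Proof.
move=> c u1 u2; pose d := (msupp u1 `|` msupp u2)%fset.
have d1 : (msupp u1 `<=` d)%fset by apply: fsubsetUl.
have d2 : (msupp u2 `<=` d)%fset by apply: fsubsetUr.
have d12 : (msupp (c *: u1 + u2) `<=` d)%fset.
  apply: (fsubset_trans (msuppD_le _ _)); rewrite fsubUset d2 andbT.
  exact: fsubset_trans (msuppZ_le _ _) d1.
rewrite (free_actEw _ d1) (free_actEw _ d2) (free_actEw _ d12).
rewrite scaler_sumr -big_split /=; apply: eq_bigr => m _.
by rewrite mcoeffD mcoeffZ scalerDl scalerA.
Qed.

Lemma free_actD u1 u2 v : free_act (u1 + u2) v = free_act u1 v + free_act u2 v.
Proof. by have := free_act_linearl v 1 u1 u2; rewrite !scale1r. Qed.

Lemma free_actB u1 u2 v : free_act (u1 - u2) v = free_act u1 v - free_act u2 v.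
Proof.
by rewrite addrC -(scaleN1r u2) free_act_linearl scaleN1r addrC.
Qed.

Lemma free_actU a m v : free_act << a *g m >> v = a *: foldr T v (m : seq I).
Proof.
by rewrite (free_actEw _ msuppU_le) big_seq_fset1 mcoeffUU.
Qed.

Lemma free_act1 v : free_act 1 v = v.
Proof. by rewrite free_actU scale1r fm1. Qed.

Lemma free_act_genM i u v : free_act (free_gen R i * u) v = T i (free_act u v).
Proof.
have TL := T_linear i.
pose Ti : {linear V -> V} :=
  HB.pack (T i) (GRing.isLinear.Build R V V _ (T i) TL).
have act_sum (r : seq {fmonom I}) (F : {fmonom I} -> free_alg R I) w :
    free_act (\sum_(m <- r) F m) w = \sum_(m <- r) free_act (F m) w.
  pose A : {linear free_alg R I -> V} := HB.pack (free_act^~ w)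
    (GRing.isLinear.Build _ _ _ _ (free_act^~ w) (free_act_linearl w)).
  exact: (raddf_sum A).
rewrite {1}(monalgE u) mulr_sumr act_sum [RHS](raddf_sum Ti).
apply: eq_bigr => m _; rewrite free_gen.unlock [_ * _]fgmulUU mul1r.
by rewrite free_actU fmuE [mmul _ _]fmmulE /= [RHS](linearZZ Ti).
Qed.

Lemma free_act_gen i v : free_act (free_gen R i) v = T i v.
Proof. by rewrite -[free_gen R i]mulr1 free_act_genM free_act1. Qed.

Lemma free_act_linearr u : linear (free_act u).
Proof.
move=> c v w; elim/free_alg_ind: u => [a u1 u2 IH1 IH2||i u IH].
- rewrite !free_act_linearl IH1 IH2 !scalerDr !scalerA.
  by rewrite [a * c]mulrC addrACA.
- by rewrite !free_act1.
- by rewrite !free_act_genM IH T_linear.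
Qed.

Lemma free_actM u1 u2 v : free_act (u1 * u2) v = free_act u1 (free_act u2 v).
Proof.
elim/free_alg_ind: u1 => [c x y IHx IHy||i x IH].
- rewrite mulrDl -(scalerAl c x) [LHS]free_act_linearl IHx IHy.
  by rewrite [RHS]free_act_linearl.
- by rewrite mul1r free_act1.
- by rewrite -(mulrA _ x) [LHS]free_act_genM IH (free_act_genM i x).
Qed.

Lemma free_act_anticomm i1 i2 i3 v :
  free_act (anticomm (free_gen R i1) (free_gen R i2) - free_gen R i3) v =
  T i1 (T i2 v) + T i2 (T i1 v) - T i3 v.
Proof.
by rewrite free_actB free_actD (free_act_genM i1) (free_act_genM i2)
  !free_act_gen.
Qed.

(** Commutation with the generators passes to words letter by letter, and then to linear
    combinations. *)
Lemma free_act_commutes c :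
    (forall i v, free_act c (T i v) = T i (free_act c v)) ->
  forall u v, free_act (c * u - u * c) v = 0.
Proof.
move=> cT u v; rewrite free_actB (free_actM c) (free_actM u).
apply/eqP; rewrite subr_eq0; apply/eqP.
elim/free_alg_ind: u => [a x y IHx IHy||i x IH].
- by rewrite !free_act_linearl free_act_linearr IHx IHy.
- by rewrite !free_act1.
- by rewrite !free_act_genM cT IH.
Qed.

(** The elements acting as zero form a two-sided ideal, which contains the one generated by
    [rel]. *)
Lemma free_act_ideal (rel : set (free_alg R I)) :
    (forall u v, rel u -> free_act u v = 0) ->
  forall u v, ideal_span rel u -> free_act u v = 0.
Proof.
move=> rel0 u v; have act0 w : free_act 0 w = 0.
  by rewrite /free_act msupp0 big_seq_fset0.
suff: (ideal_span rel `<=` [set u | forall v, free_act u v = 0])%classic.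
  by move=> /(_ u)/[apply]/(_ v).
apply: smallest_sub => [|w /rel0 //]; split=> //=.
- by move=> a b a0 b0 w; rewrite free_actB a0 b0 subr0.
(* Linearity at [-1], [0], [0] shows that [a] sends [0] to [0]. *)
- move=> a b b0 w; rewrite free_actM b0; have := free_act_linearr a (-1) 0 0.
  by rewrite scaleN1r oppr0 addr0 => ->; rewrite scaleN1r addNr.
- by move=> a b b0 w; rewrite free_actM b0.
Qed.

Variable rel : set (free_alg R I).
Hypothesis rel_act : forall u v, rel u -> free_act u v = 0.

Definition pres_act (x : presented rel) (v : V) : V := free_act (repr x) v.

(** The chosen representative differs from [u] by an element of the ideal, which acts as zero. *)
Lemma pres_act_proj u v : pres_act (pres_proj rel u) v = free_act u v.
Proof.
have : ideal_span rel (repr (pres_proj rel u) - u).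
  by apply/pres_projE; rewrite pres_projK.
move=> /(free_act_ideal rel_act v).
by rewrite free_actB => /eqP; rewrite subr_eq0 => /eqP.
Qed.

Lemma pres_act_linearl v : linear (pres_act^~ v).
Proof.
move=> c x y; rewrite -(pres_projK x) -(pres_projK y) -linearP !pres_act_proj.
exact: free_act_linearl.
Qed.

Lemma pres_actM x y v : pres_act (x * y) v = pres_act x (pres_act y v).
Proof.
rewrite -(pres_projK x) -(pres_projK y) -rmorphM !pres_act_proj.
exact: free_actM.
Qed.

Lemma pres_act1 v : pres_act 1 v = v.
Proof. by rewrite -(rmorph1 (@pres_proj R I rel)) pres_act_proj free_act1. Qed.

Lemma pres_act_gen i v : pres_act (pres_gen rel i) v = T i v.
Proof. by rewrite pres_act_proj free_act_gen. Qed.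

Lemma pres_actD x y v : pres_act (x + y) v = pres_act x v + pres_act y v.
Proof. by have := pres_act_linearl v 1 x y; rewrite !scale1r. Qed.

Lemma pres_act_anticomm i1 i2 v :
  pres_act (anticomm (pres_gen rel i1) (pres_gen rel i2)) v =
  T i1 (T i2 v) + T i2 (T i1 v).
Proof. by rewrite pres_actD !pres_actM !pres_act_gen. Qed.

Lemma pres_act_anticommB i1 i2 i3 v :
  pres_act (anticomm (pres_gen rel i1) (pres_gen rel i2) - pres_gen rel i3) v =
  T i1 (T i2 v) + T i2 (T i1 v) - T i3 v.
Proof.
by rewrite -pres_proj_anticomm pres_act_proj free_act_anticomm.
Qed.

End WordAction.

(** * The coinduced module *)

Section Coinduced.
Variables (R : comNzRingType) (kap lam mu zeta : R).

(* [f j k] stands for the value on [Y^j Z^k] of a functional [f] on the module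
   induced from the character [X |-> zeta]; the [coind_*] are the transposes of
   right multiplication, so [(X^i Y^j Z^k f) 0 0 = zeta^i * f j k]. *)
Local Notation V := (nat -> nat -> R).

Definition coind_Z (f : V) : V := fun j k => f j k.+1.

(** The values of [X f] and [Y f] at [(j, k)], computed together because [Z X = Y + mu - X Z] and
    [Z Y = X + lam - Y Z] call each other as [k] decreases; [x0] supplies [X f] at [(j, 0)]. *)
Fixpoint coind_step (x0 : nat -> V -> R) (k j : nat) (f : V) : R * R :=
  if k is k'.+1 then
    let u := coind_step x0 k' j f in
    let v := coind_step x0 k' j (coind_Z f) in
    (u.2 + mu * f j k' - v.1, u.1 + lam * f j k' - v.2)
  else (x0 j f, f j.+1 0%N).

(* [coind_base n j f] is the value of [X f] at [(j, 0)], for [j <= n] only: the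
   recursion [X Y = Z + kap - Y X] calls [X f] again on all smaller rows. *)
Fixpoint coind_base (n : nat) (j : nat) (f : V) : R :=
  if n is n'.+1 then
    if (j <= n')%N then coind_base n' j f
    else f n' 1%N + kap * f n' 0%N
      - coind_base n' n' (fun j k => (coind_step (coind_base n') k j f).2)
  else zeta * f 0%N 0%N.

Definition coind_X (f : V) : V :=
  fun j k => (coind_step (fun j => coind_base j j) k j f).1.
Definition coind_Y (f : V) : V :=
  fun j k => (coind_step (fun j => coind_base j j) k j f).2.

Lemma coind_base_stable n j f : (j <= n)%N ->
  coind_base n j f = coind_base j j f.
Proof.
elim: n => [|n IH]; first by rewrite leqn0 => /eqP ->.
rewrite leq_eqVlt => /predU1P[-> //|]; rewrite ltnS => jn /=.
by rewrite jn IH.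
Qed.

(** The recursion on [k] stays in row [j], since [coind_Z] shifts only [k]; the sole look-ahead is
    the entry [f j.+1 0] at [k = 0]. *)
Lemma coind_step_local (x0 x1 : nat -> V -> R) j k f g :
    (forall f g, (forall j' k, (j' <= j)%N -> f j' k = g j' k) ->
      x0 j f = x1 j g) ->
    (forall j' k, (j' <= j.+1)%N -> f j' k = g j' k) ->
  coind_step x0 k j f = coind_step x1 k j g.
Proof.
move=> x01; elim: k f g => [|k IH] f g fg /=.
  by rewrite fg // (x01 f g) // => j' k /leqW; exact: fg.
rewrite (IH f g fg) (IH (coind_Z f) (coind_Z g)) ?fg //.
by move=> j' k' /fg; apply.
Qed.

(** Row [j <= n] of [Y f] reads rows of [f] up to [j.+1 <= n.+1], so the value at [(n.+1, 0)]
    depends on no later row. Functions that agree only on these rows can thus be exchanged under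
    [coind_X]. *)
Lemma coind_base_local n f g :
    (forall j k, (j <= n)%N -> f j k = g j k) ->
  coind_base n n f = coind_base n n g.
Proof.
elim/ltn_ind: n f g => -[|n] IH f g fg /=; first by rewrite fg.
rewrite ltnn !fg //; congr (_ - _); apply: (IH) => // j k jn.
congr (_.2); apply: coind_step_local => [f' g' fg'|j' k' j'j]; last first.
  by apply: fg; apply: leq_trans j'j _.
by rewrite !(coind_base_stable _ jn); apply: IH.
Qed.

Lemma coind_XE0 f : coind_X f 0%N 0%N = zeta * f 0%N 0%N.
Proof. by []. Qed.

Lemma coind_YE0 f j : coind_Y f j 0%N = f j.+1 0%N.
Proof. by []. Qed.

Lemma coind_XES f j k :
  coind_X f j k.+1 = coind_Y f j k + mu * f j k - coind_X (coind_Z f) j k.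
Proof. by []. Qed.

Lemma coind_YES f j k :
  coind_Y f j k.+1 = coind_X f j k + lam * f j k - coind_Y (coind_Z f) j k.
Proof. by []. Qed.

(** The recursion uses a partial [Y] built from a bounded [coind_base]; it agrees with [coind_Y] on
    the rows up to [j], the only ones read. *)
Lemma coind_XES0 f j :
  coind_X f j.+1 0%N = f j 1%N + kap * f j 0%N - coind_X (coind_Y f) j 0%N.
Proof.
rewrite /coind_X /= ltnn; congr (_ - _); apply: coind_base_local => j' k j'j.
congr (_.2); apply: coind_step_local => [f' g' fg'|//].
by rewrite coind_base_stable //; apply: coind_base_local.
Qed.

(** [X] and [Y] are mutually recursive, so one induction serves both claims: on the row [j], and
    within a row on [k]. *)
Lemma coind_XY_linear (a : R) (f g : V) j k :
  coind_X (fun j k => a * f j k + g j k) j k =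
    a * coind_X f j k + coind_X g j k /\
  coind_Y (fun j k => a * f j k + g j k) j k =
    a * coind_Y f j k + coind_Y g j k.
Proof.
elim/ltn_ind: j k f g => j IHj; elim=> [|k IHk] f g; last first.
  rewrite !coind_XES !coind_YES.
  have [-> ->] := IHk f g; have [-> ->] := IHk (coind_Z f) (coind_Z g).
  by split; ring.
split=> //; case: j IHj => [|j] IHj; first by rewrite !coind_XE0; ring.
rewrite !coind_XES0.
(* Linearity of [coind_Y] is known here only on rows up to [j], which is all that [coind_X] reads at
   [(j, 0)]. *)
have -> : coind_X (coind_Y (fun j k => a * f j k + g j k)) j 0 =
    coind_X (fun j k => a * coind_Y f j k + coind_Y g j k) j 0.
  by apply: coind_base_local => j' k j'j; have [_ ->] := IHj j' j'j k f g.
by have [-> _] := IHj j (ltnSn j) 0%N (coind_Y f) (coind_Y g); ring.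
Qed.

Lemma coind_YZ f j k :
  coind_Y (coind_Z f) j k + coind_Z (coind_Y f) j k =
  coind_X f j k + lam * f j k.
Proof. by rewrite /coind_Z coind_YES addrC subrK. Qed.

Lemma coind_ZX f j k :
  coind_Z (coind_X f) j k + coind_X (coind_Z f) j k =
  coind_Y f j k + mu * f j k.
Proof. by rewrite /coind_Z coind_XES subrK. Qed.

(* This is the one relation that does not hold by construction. Its induction
   step is the overlap [X Y Z]: moving [Z] through [X Y + Y X] produces only
   terms that cancel, apart from [(X Y + Y X) Z] itself. *)
Lemma coind_XY f j k :
  coind_X (coind_Y f) j k + coind_Y (coind_X f) j k =
  coind_Z f j k + kap * f j k.
Proof.
elim: k f => [|k IH] f; first by rewrite coind_YE0 coind_XES0 addrC subrK.
rewrite coind_XES coind_YES.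
(* Writing [Z Y f] and [Z X f] as linear combinations lets [coind_XY_linear] distribute [X] and [Y]
   over them. *)
have -> : coind_Z (coind_Y f) = fun j k =>
    - 1 * coind_Y (coind_Z f) j k + (lam * f j k + coind_X f j k).
  by apply/funext => j'; apply/funext => k'; have := coind_YZ f j' k';
     move/(canRL (addKr _)) ->; ring.
have -> : coind_Z (coind_X f) = fun j k =>
    - 1 * coind_X (coind_Z f) j k + (mu * f j k + coind_Y f j k).
  by apply/funext => j'; apply/funext => k'; have := coind_ZX f j' k';
     move/(canRL (addrK _)) ->; ring.
have [-> _] := coind_XY_linear (-1) (coind_Y (coind_Z f))
  (fun j k => lam * f j k + coind_X f j k) j k.
have [_ ->] := coind_XY_linear (-1) (coind_X (coind_Z f))
  (fun j k => mu * f j k + coind_Y f j k) j k.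
have [-> _] := coind_XY_linear lam f (coind_X f) j k.
have [_ ->] := coind_XY_linear mu f (coind_Y f) j k.
have := IH (coind_Z f); rewrite {3}/coind_Z => E.
have -> : coind_Z f j k.+1 = coind_Z (coind_Z f) j k by [].
rewrite -[RHS]E; ring.
Qed.

End Coinduced.

(** * The action of the Bannai-Ito algebra on the coinduced module *)

Section BIAction.
Variables (F : fieldType) (kap lam mu zeta : {poly F}).

Local Notation V := (nat -> nat -> {poly F}).
Local Notation cX := (coind_X kap lam mu zeta).
Local Notation cY := (coind_Y kap lam mu zeta).

Definition bi_op (i : 'I_3) : V -> V :=
  match val i with 0 => cX | 1 => cY | _ => @coind_Z _ end.

(** The coefficient is a polynomial rather than an element of [F], so that multiplication by [kap],
    [lam] or [mu] commutes with the operators. *)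
Lemma bi_op_linear p f g i :
  bi_op i (fun j k => p * f j k + g j k) =
  fun j k => p * bi_op i f j k + bi_op i g j k.
Proof.
apply/funext => j; apply/funext => k.
have [lX lY] := coind_XY_linear kap lam mu zeta p f g j k.
by case: i => -[|[|[|]]].
Qed.

Lemma bi_op_is_linear i : linear (bi_op i).
Proof.
move=> c f g; have := bi_op_linear c%:P f g i.
have scaleE h : c *: h = (fun j k => c%:P * h j k) :> V.
  by apply/funext => j; apply/funext => k; rewrite mul_polyC.
by rewrite !scaleE.
Qed.

Lemma bi_op_kappa f :
  bi_op iX (bi_op iY f) + bi_op iY (bi_op iX f) - bi_op iZ f =
  fun j k => kap * f j k.
Proof.
apply/funext => j; apply/funext => k.
by rewrite -[RHS](addrK (coind_Z f j k)) [_ + coind_Z f j k]addrC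
  -(coind_XY kap lam mu zeta).
Qed.

Lemma bi_op_lambda f :
  bi_op iY (bi_op iZ f) + bi_op iZ (bi_op iY f) - bi_op iX f =
  fun j k => lam * f j k.
Proof.
apply/funext => j; apply/funext => k.
by rewrite -[RHS](addrK (cX f j k)) [_ + cX f j k]addrC
  -(coind_YZ kap lam mu zeta).
Qed.

Lemma bi_op_mu f :
  bi_op iZ (bi_op iX f) + bi_op iX (bi_op iZ f) - bi_op iY f =
  fun j k => mu * f j k.
Proof.
apply/funext => j; apply/funext => k.
by rewrite -[RHS](addrK (cY f j k)) [_ + cY f j k]addrC
  -(coind_ZX kap lam mu zeta).
Qed.

Lemma bi_op_scale p i g :
  bi_op i (fun j k => p * g j k) = fun j k => p * bi_op i g j k.
Proof.
have op0 : bi_op i 0 = 0.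
  by have := bi_op_is_linear i (-1) 0 0; rewrite !scaleN1r !addNr.
have -> : (fun j k => p * g j k) = (fun j k => p * g j k + (0 : V) j k).
  by apply/funext => j; apply/funext => k; rewrite addr0.
rewrite bi_op_linear op0.
by apply/funext => j; apply/funext => k; rewrite addr0.
Qed.

(** Each of the three central elements acts as multiplication by a polynomial, and this commutes
    with the operators. *)
Lemma bi_rel_act u f : bi_rel F u -> free_act bi_op u f = 0.
Proof.
case=> c c_rel [w _ <-]; apply: free_act_commutes => [|i v].
  exact: bi_op_is_linear.
have [p cE] : exists p, forall g, free_act bi_op c g = fun j k => p * g j k.
  move: c_rel; rewrite /= !inE => /or3P[] /eqP ->.
  - by exists kap => g;
    rewrite (free_act_anticomm bi_op_is_linear) bi_op_kappa.
  - by exists lam => g;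
    rewrite (free_act_anticomm bi_op_is_linear) bi_op_lambda.
  - by exists mu => g;
    rewrite (free_act_anticomm bi_op_is_linear) bi_op_mu.
by rewrite !cE bi_op_scale.
Qed.

Definition bi_act (x : BI F) (f : V) : V := pres_act bi_op x f.

Lemma bi_act_linear f : linear (bi_act^~ f).
Proof.
by move=> c x y; exact: (pres_act_linearl bi_op_is_linear bi_rel_act).
Qed.

Lemma bi_actM x y f : bi_act (x * y) f = bi_act x (bi_act y f).
Proof. exact: (pres_actM bi_op_is_linear bi_rel_act). Qed.

Lemma bi_act1 f : bi_act 1 f = f.
Proof. exact: (pres_act1 bi_op_is_linear bi_rel_act). Qed.

Lemma bi_act_gen i f : bi_act (pres_gen (bi_rel F) i) f = bi_op i f.
Proof. exact: (pres_act_gen bi_op_is_linear bi_rel_act). Qed.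

Lemma bi_act_anticomm i1 i2 f :
  bi_act (anticomm (pres_gen (bi_rel F) i1) (pres_gen (bi_rel F) i2)) f =
  bi_op i1 (bi_op i2 f) + bi_op i2 (bi_op i1 f).
Proof. exact: (pres_act_anticomm bi_op_is_linear bi_rel_act). Qed.

Lemma bi_act_anticommB i1 i2 i3 f :
  bi_act (anticomm (pres_gen (bi_rel F) i1) (pres_gen (bi_rel F) i2) -
          pres_gen (bi_rel F) i3) f =
  bi_op i1 (bi_op i2 f) + bi_op i2 (bi_op i1 f) - bi_op i3 f.
Proof. exact: (pres_act_anticommB bi_op_is_linear bi_rel_act). Qed.

Lemma bi_act_exp x p i f : (forall f, bi_act x f = fun j k => p * f j k) ->
  bi_act (x ^+ i) f = fun j k => p ^+ i * f j k.
Proof.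
move=> xp; elim: i => [|i IH].
  by rewrite bi_act1; apply/funext => j; apply/funext => k; rewrite mul1r.
rewrite exprS bi_actM xp IH.
by apply/funext => j; apply/funext => k; rewrite exprS mulrA.
Qed.

Lemma bi_act_Xexp i f : bi_act (bi_X F ^+ i) f 0%N 0%N = zeta ^+ i * f 0%N 0%N.
Proof.
elim: i f => [|i IH] f; first by rewrite bi_act1 mul1r.
rewrite exprSr bi_actM IH bi_act_gen exprSr -mulrA.
by have -> : bi_op iX f 0%N 0%N = zeta * f 0%N 0%N by [].
Qed.

Lemma bi_act_Yexp i f : bi_act (bi_Y F ^+ i) f 0%N 0%N = f i 0%N.
Proof.
suff E j : bi_act (bi_Y F ^+ i) f j 0%N = f (j + i)%N 0%N by rewrite E.
elim: i f => [|i IH] f; first by rewrite bi_act1 addn0.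
by rewrite exprSr bi_actM IH bi_act_gen addnS.
Qed.

Lemma bi_act_Zexp i f j k : bi_act (bi_Z F ^+ i) f j k = f j (k + i)%N.
Proof.
elim: i f => [|i IH] f; first by rewrite bi_act1 addn0.
by rewrite exprSr bi_actM IH bi_act_gen /bi_op /coind_Z addnS.
Qed.

(** Evaluation at [(0, 0)] reads the monomial from the left: [X^i] contributes [zeta^i], [Y^j] moves
    the point to [(j, 0)], [Z^k] moves it on to [(j, k)], and the central powers act as scalars. *)
Lemma bi_act_monomial i j k r s t f :
  bi_act (bi_X F ^+ i * bi_Y F ^+ j * bi_Z F ^+ k *
          bi_kappa F ^+ r * bi_lambda F ^+ s * bi_mu F ^+ t) f 0%N 0%N =
  zeta ^+ i * kap ^+ r * lam ^+ s * mu ^+ t * f j k.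
Proof.
rewrite !bi_actM bi_act_Xexp bi_act_Yexp bi_act_Zexp.
rewrite (@bi_act_exp _ kap) => [|g];
  last by rewrite bi_act_anticommB bi_op_kappa.
rewrite (@bi_act_exp _ lam) => [|g];
  last by rewrite bi_act_anticommB bi_op_lambda.
rewrite (@bi_act_exp _ mu) => [|g];
  last by rewrite bi_act_anticommB bi_op_mu.
by rewrite !mulrA.
Qed.

Lemma bi_act_anticommXY f :
  bi_act (anticomm (bi_X F) (bi_Y F)) f 0%N 0%N = f 0%N 1%N + kap * f 0%N 0%N.
Proof. by rewrite bi_act_anticomm; exact: (coind_XY kap lam mu zeta). Qed.

Lemma bi_act_anticommYZ f :
  bi_act (anticomm (bi_Y F) (bi_Z F)) f 0%N 0%N =
  zeta * f 0%N 0%N + lam * f 0%N 0%N.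
Proof. by rewrite bi_act_anticomm; exact: (coind_YZ kap lam mu zeta). Qed.

Lemma bi_act_anticommZX f :
  bi_act (anticomm (bi_Z F) (bi_X F)) f 0%N 0%N = f 1%N 0%N + mu * f 0%N 0%N.
Proof. by rewrite bi_act_anticomm; exact: (coind_ZX kap lam mu zeta). Qed.

End BIAction.

(** * Straightening *)

Section Span.
Variables (F : fieldType).

Lemma subspaceP (V : lmodType F) (S : set V) :
  subspace S <-> S 0 /\ forall a u v, S u -> S v -> S (a *: u + v).
Proof.
split=> -[S0 SL]; split=> [|a u v]; rewrite ?in_setE //.
- by move: S0; rewrite in_setE.
- by move=> Su Sv; rewrite -in_setE; apply: SL; rewrite in_setE.
- exact: SL.
Qed.

Lemma subspaceB (V : lmodType F) (S : set V) u v :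
  subspace S -> S u -> S v -> S (u - v).
Proof.
by move=> /subspaceP[_ SL] Su Sv; rewrite addrC -scaleN1r; apply: SL.
Qed.

Lemma subspaceD (V : lmodType F) (S : set V) u v :
  subspace S -> S u -> S v -> S (u + v).
Proof. by move=> /subspaceP[_ SL] Su Sv; rewrite -[u]scale1r; apply: SL. Qed.

Lemma lspan_subspace (V : lmodType F) (S : set V) : subspace (lspan S).
Proof.
apply/subspaceP; split=> [P [/subspaceP[]] //|a u v Su Sv P [PS SP]].
by have /subspaceP[_ PL] := PS; apply: PL; [apply: Su|apply: Sv].
Qed.

Lemma lspan_mull (A : algType F) (S P : set A) (a : A) : subspace P ->
  (forall v, S v -> P (a * v)) -> forall v, lspan S v -> P (a * v).
Proof.
move=> /subspaceP[P0 PL] SP v.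
suff: (lspan S `<=` [set v | P (a * v)])%classic by apply.
apply: smallest_sub => //; apply/subspaceP; split=> [|c u w Pu Pw] /=.
  by rewrite mulr0.
by rewrite mulrDr -scalerAr; apply: PL.
Qed.

Lemma lspan_mulr (A : algType F) (S P : set A) (a : A) : subspace P ->
  (forall v, S v -> P (v * a)) -> forall v, lspan S v -> P (v * a).
Proof.
move=> /subspaceP[P0 PL] SP v.
suff: (lspan S `<=` [set v | P (v * a)])%classic by apply.
apply: smallest_sub => //; apply/subspaceP; split=> [|c u w Pu Pw] /=.
  by rewrite mul0r.
by rewrite mulrDl -scalerAl; apply: PL.
Qed.

End Span.

Section Straightening.
Variables (F : fieldType) (A : algType F) (x y z kp lm mm : A).
Hypotheses (kpC : forall a, kp * a = a * kp) (lmC : forall a, lm * a = a * lm)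
  (mmC : forall a, mm * a = a * mm).
Hypotheses (yx : y * x = z + kp - x * y) (zy : z * y = x + lm - y * z)
  (zx : z * x = y + mm - x * z).
Variables wX wY wZ wk wl wm : nat.

Let mono i j k r s t : A :=
  x ^+ i * y ^+ j * z ^+ k * kp ^+ r * lm ^+ s * mm ^+ t.
Let wt i j k r s t : nat :=
  (wX * i + wY * j + wZ * k + wk * r + wl * s + wm * t)%N.

(* Bounding the exponent of [y] makes the induction well-founded: rewriting
   [z y^(J+1)] calls for [y] times [z y^J], whose [y]-exponents are at most
   [J], whereas the weights may all vanish. *)
Definition weight_span (J n : nat) : set A := lspan [set v |
  exists i j k r s t, [/\ (j <= J)%N, (wt i j k r s t <= n)%N
                        & v = mono i j k r s t]].

Let mono_x i j k r s t : x * mono i j k r s t = mono i.+1 j k r s t.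
Proof. by rewrite /mono !mulrA -exprS. Qed.

Let mono_kp i j k r s t : kp * mono i j k r s t = mono i j k r.+1 s t.
Proof.
rewrite /mono; move: (x ^+ i * y ^+ j * z ^+ k) => a.
by rewrite !(mulrA kp) (kpC a) -(mulrA a kp) -exprS.
Qed.

Let mono_lm i j k r s t : lm * mono i j k r s t = mono i j k r s.+1 t.
Proof.
rewrite /mono; move: (x ^+ i * y ^+ j * z ^+ k * kp ^+ r) => a.
by rewrite !(mulrA lm) (lmC a) -(mulrA a lm) -exprS.
Qed.

Let mono_mm i j k r s t : mm * mono i j k r s t = mono i j k r s t.+1.
Proof.
rewrite /mono; move: (x ^+ i * y ^+ j * z ^+ k * kp ^+ r * lm ^+ s) => a.
by rewrite (mulrA mm) (mmC a) -(mulrA a mm) -exprS.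
Qed.

Let mono_y j k r s t : y * mono 0%N j k r s t = mono 0%N j.+1 k r s t.
Proof. by rewrite /mono !mul1r !mulrA -exprS. Qed.

Let mono_z k r s t : z * mono 0%N 0%N k r s t = mono 0%N 0%N k.+1 r s t.
Proof. by rewrite /mono !mul1r !mulrA -exprS. Qed.

Let mono_in J n i j k r s t : (j <= J)%N -> (wt i j k r s t <= n)%N ->
  weight_span J n (mono i j k r s t).
Proof.
by move=> jJ wn; apply: sub_gen_smallest; exists i, j, k, r, s, t.
Qed.

Lemma weight_span_subspace J n : subspace (weight_span J n).
Proof. exact: lspan_subspace. Qed.

Lemma weight_span_le J J' n n' v : (J <= J')%N -> (n <= n')%N ->
  weight_span J n v -> weight_span J' n' v.
Proof.
move=> JJ nn; apply: smallest_sub; first exact: lspan_subspace.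
move=> _ [i [j [k [r [s [t [jJ wn ->]]]]]]].
by apply: mono_in; [apply: leq_trans JJ|apply: leq_trans nn].
Qed.

Lemma weight_span_x J n v : weight_span J n v -> weight_span J (n + wX) (x * v).
Proof.
apply: lspan_mull; first exact: lspan_subspace.
move=> _ [i [j [k [r [s [t [jJ wn ->]]]]]]]; rewrite mono_x.
by apply: mono_in => //; rewrite /wt in wn *; nia.
Qed.

Hypotheses (wkXY : (maxn wZ wk <= wX + wY)%N) (wlYZ : (maxn wX wl <= wY + wZ)%N)
  (wmZX : (maxn wY wm <= wZ + wX)%N).

Let weights : [/\ (wZ <= wX + wY)%N, (wk <= wX + wY)%N, (wX <= wY + wZ)%N,
  (wl <= wY + wZ)%N & (wY <= wZ + wX)%N /\ (wm <= wZ + wX)%N].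
Proof.
by move: wkXY wlYZ wmZX; rewrite !geq_max => /andP[? ?] /andP[? ?] /andP[].
Qed.

(** Induction on [i], for [y] and [z] together: moving either of them past a leading [x] produces
    the other. At [i = 0] the claim for [y] is immediate and that for [z] is the hypothesis. *)
Let straight_yz J :
    (forall k r s t, weight_span J (wt 0%N J k r s t + wZ)
      (z * mono 0%N J k r s t)) ->
  forall i k r s t,
    weight_span J.+1 (wt i J k r s t + wY) (y * mono i J k r s t) /\
    weight_span J.+1 (wt i J k r s t + wZ) (z * mono i J k r s t).
Proof.
have [wZXY wkXY' wXYZ wlYZ' [wYZX wmZX']] := weights.
move=> HJ; elim=> [|i IH] k r s t.
  split; last by apply: (weight_span_le (leqnSn J) (leqnn _)).
  by rewrite mono_y; apply: mono_in => //; rewrite /wt; nia.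
have [IHy IHz] := IH k r s t.
rewrite -mono_x (mulrA y) (mulrA z) yx zx !mulrBl !mulrDl.
split; apply: (subspaceB (weight_span_subspace _ _)).
- apply: (subspaceD (weight_span_subspace _ _)).
    by apply: weight_span_le IHz => //; rewrite /wt; nia.
  by rewrite mono_kp; apply: mono_in; rewrite /wt //; nia.
- rewrite -mulrA; apply: weight_span_le (weight_span_x IHy) => //.
  by rewrite /wt; nia.
- apply: (subspaceD (weight_span_subspace _ _)).
    by apply: weight_span_le IHy => //; rewrite /wt; nia.
  by rewrite mono_mm; apply: mono_in; rewrite /wt //; nia.
- rewrite -mulrA; apply: weight_span_le (weight_span_x IHz) => //.
  by rewrite /wt; nia.
Qed.

Let straight_span J :
    (forall J' k r s t, (J' <= J)%N ->
      weight_span J' (wt 0%N J' k r s t + wZ) (z * mono 0%N J' k r s t)) ->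
  forall n v, weight_span J n v ->
    weight_span J.+1 (n + wY) (y * v) /\ weight_span J.+1 (n + wZ) (z * v).
Proof.
move=> HJ n v Pv.
have gen i j k r s t : (j <= J)%N -> (wt i j k r s t <= n)%N ->
    weight_span J.+1 (n + wY) (y * mono i j k r s t) /\
    weight_span J.+1 (n + wZ) (z * mono i j k r s t).
  move=> jJ wn; have [|Hy Hz] := @straight_yz j _ i k r s t.
    by move=> *; apply: HJ.
  split; first by apply: weight_span_le Hy; rewrite ?leq_add2r.
  by apply: weight_span_le Hz; rewrite ?leq_add2r.
by split; move: v Pv; apply: lspan_mull (weight_span_subspace _ _) _;
  move=> _ [i [j [k [r [s [t [jJ wn ->]]]]]]]; have [] := gen i j k r s t jJ wn.
Qed.

Let straight_z J k r s t :
  weight_span J (wt 0%N J k r s t + wZ) (z * mono 0%N J k r s t).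
Proof.
have [_ _ wXYZ wlYZ' _] := weights.
elim/ltn_ind: J k r s t => -[|J] IH k r s t.
  by rewrite mono_z; apply: mono_in => //; rewrite /wt; nia.
rewrite -mono_y (mulrA z) zy mulrBl mulrDl.
apply: (subspaceB (weight_span_subspace _ _)).
  apply: (subspaceD (weight_span_subspace _ _)).
    by rewrite mono_x; apply: mono_in => //; rewrite /wt; nia.
  by rewrite mono_lm; apply: mono_in => //; rewrite /wt; nia.
(* The induction hypothesis puts [z] times the monomial with [y]-exponent [J] in [weight_span J];
   all [y]-exponents there are at most [J], so [straight_span] controls the further factor [y]. *)
rewrite -mulrA; have [|H _] := @straight_span J _ _ _ (IH J (ltnSn J) k r s t).
  by move=> J' k' r' s' t' J'J; apply: IH.
by apply: weight_span_le H => //; rewrite /wt; nia.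
Qed.

(** * The weight filtration, without a bound on the exponent of [y] *)

Definition weight_filtration (n : nat) : set A := lspan [set v |
  exists i j k r s t, (wt i j k r s t <= n)%N /\ v = mono i j k r s t].

Let filt_in n i j k r s t : (wt i j k r s t <= n)%N ->
  weight_filtration n (mono i j k r s t).
Proof. by move=> wn; apply: sub_gen_smallest; exists i, j, k, r, s, t. Qed.

Let filt_sub n : subspace (weight_filtration n).
Proof. exact: lspan_subspace. Qed.

Lemma weight_span_filtration J n v :
  weight_span J n v -> weight_filtration n v.
Proof.
apply: smallest_sub; first exact: filt_sub.
by move=> _ [i [j [k [r [s [t [jJ wn ->]]]]]]]; apply: filt_in.
Qed.

Lemma weight_filtration_le n n' v : (n <= n')%N ->
  weight_filtration n v -> weight_filtration n' v.
Proof.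
move=> nn; apply: smallest_sub; first exact: filt_sub.
move=> _ [i [j [k [r [s [t [wn ->]]]]]]]; apply: filt_in.
exact: leq_trans nn.
Qed.

Let filt_gen a w n :
    (forall i j k r s t, weight_filtration (wt i j k r s t + w)
       (a * mono i j k r s t)) ->
  forall v, weight_filtration n v -> weight_filtration (n + w) (a * v).
Proof.
move=> H; apply: lspan_mull (filt_sub _) _.
move=> _ [i [j [k [r [s [t [wn ->]]]]]]].
by apply: weight_filtration_le (H i j k r s t); rewrite leq_add2r.
Qed.

Lemma weight_filtration_x n v :
  weight_filtration n v -> weight_filtration (n + wX) (x * v).
Proof.
apply: filt_gen => i j k r s t; rewrite mono_x.
by apply: filt_in; rewrite /wt; nia.
Qed.

Lemma weight_filtration_y n v :
  weight_filtration n v -> weight_filtration (n + wY) (y * v).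
Proof.
apply: filt_gen => i j k r s t.
have [Hy _] := @straight_yz j (@straight_z j) i k r s t.
exact: weight_span_filtration Hy.
Qed.

Lemma weight_filtration_z n v :
  weight_filtration n v -> weight_filtration (n + wZ) (z * v).
Proof.
apply: filt_gen => i j k r s t.
have [_ Hz] := @straight_yz j (@straight_z j) i k r s t.
exact: weight_span_filtration Hz.
Qed.

Lemma weight_filtration_kp n v :
  weight_filtration n v -> weight_filtration (n + wk) (kp * v).
Proof.
apply: filt_gen => i j k r s t; rewrite mono_kp.
by apply: filt_in; rewrite /wt; nia.
Qed.

Lemma weight_filtration_lm n v :
  weight_filtration n v -> weight_filtration (n + wl) (lm * v).
Proof.
apply: filt_gen => i j k r s t; rewrite mono_lm.
by apply: filt_in; rewrite /wt; nia.
Qed.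

Lemma weight_filtration_mm n v :
  weight_filtration n v -> weight_filtration (n + wm) (mm * v).
Proof.
apply: filt_gen => i j k r s t; rewrite mono_mm.
by apply: filt_in; rewrite /wt; nia.
Qed.

Let filt_exp a w :
    (forall n v, weight_filtration n v -> weight_filtration (n + w) (a * v)) ->
  forall e n v, weight_filtration n v ->
    weight_filtration (w * e + n) (a ^+ e * v).
Proof.
move=> H e n v Fv; elim: e => [|e IH]; first by rewrite muln0 mul1r.
by rewrite exprS -mulrA mulnS -addnA addnC; apply: H.
Qed.

(** By linearity the left factor may be taken to be a monomial; its factors are applied to [v] one
    at a time, the rightmost first, each adding at most its own weight. *)
Lemma weight_filtrationM m n :
  (subspace_mul (weight_filtration m) (weight_filtration n)
     `<=` weight_filtration (m + n))%classic.
Proof.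
apply: smallest_sub; first exact: filt_sub.
move=> _ [u Fu [v Fv <-]]; move: u Fu.
apply: lspan_mulr (filt_sub _) _ => _ [i [j [k [r [s [t [wn ->]]]]]]].
rewrite /mono -!mulrA.
have := @filt_exp _ _ (@weight_filtration_mm) t _ _ Fv.
move=> /(@filt_exp _ _ (@weight_filtration_lm) s _ _)
  /(@filt_exp _ _ (@weight_filtration_kp) r _ _).
move=> /(@filt_exp _ _ (@weight_filtration_z) k _ _)
  /(@filt_exp _ _ (@weight_filtration_y) j _ _).
move=> /(@filt_exp _ _ (@weight_filtration_x) i _ _).
by apply: weight_filtration_le; rewrite !addnA leq_add2r.
Qed.

(** The induction principle in the hypothesis expresses generation by [x], [y], [z]. It gives
    exhaustion: the union contains [1] and is stable under linear combinations and left
    multiplication by generators. *)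
Lemma weight_filtration_filtration :
  (forall P : A -> Prop, (forall c u v, P u -> P v -> P (c *: u + v)) -> P 1 ->
    (forall u, P u -> [/\ P (x * u), P (y * u) & P (z * u)]) ->
    forall u, P u) ->
  nat_filtration weight_filtration.
Proof.
move=> gen; split.
- exact: filt_sub.
- apply/seteqP; split=> // u _.
  apply: (gen (fun u => (\bigcup_n _ n)%classic u)).
  + move=> c v w [n _ Fv] [n' _ Fw]; exists (n + n')%N => //.
    have /subspaceP[_ FL] := filt_sub (n + n'); apply: FL.
      exact: weight_filtration_le (leq_addr _ _) Fv.
    exact: weight_filtration_le (leq_addl _ _) Fw.
  + exists 0%N => //; rewrite -(_ : mono 0%N 0%N 0%N 0%N 0%N 0%N = 1).
      by apply: filt_in; rewrite /wt; nia.
    by rewrite /mono !mulr1.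
  + move=> v [n _ Fv]; split.
    * by exists (n + wX)%N => //; apply: weight_filtration_x.
    * by exists (n + wY)%N => //; apply: weight_filtration_y.
    * by exists (n + wZ)%N => //; apply: weight_filtration_z.
- by move=> n v; apply: weight_filtration_le.
- exact: weight_filtrationM.
Qed.

End Straightening.

(** * The filtration of the Bannai-Ito algebra *)

(** With [c] the third generator, [anticomm a b - c] is one of the central elements and the identity
    is a straightening rule. *)
Lemma anticomm_swapl (A : pzRingType) (a b c : A) :
  a * b = c + (anticomm a b - c) - b * a.
Proof. by rewrite addrCA subrr addr0 /anticomm addrK. Qed.

Lemma anticomm_swapr (A : pzRingType) (a b c : A) :
  b * a = c + (anticomm a b - c) - a * b.
Proof. by rewrite addrCA subrr addr0 /anticomm addrC addKr. Qed.

Section Main.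
Variables (F : fieldType) (wX wY wZ wk wl wm : nat).

Lemma bi_central_proj c x :
  c \in bi_central F -> pres_proj (bi_rel F) c * x = x * pres_proj (bi_rel F) c.
Proof.
move=> cC; rewrite -(pres_projK x) -!rmorphM; apply/pres_projE.
by apply: sub_gen_smallest; exists c => //; exists (repr x).
Qed.

Lemma bi_kappaC x : bi_kappa F * x = x * bi_kappa F.
Proof.
rewrite -[bi_kappa F](@pres_proj_anticomm _ _ (bi_rel F) iX iY iZ).
apply: bi_central_proj; rewrite !inE; apply/or3P; apply: Or31; exact: eqxx.
Qed.

Lemma bi_lambdaC x : bi_lambda F * x = x * bi_lambda F.
Proof.
rewrite -[bi_lambda F](@pres_proj_anticomm _ _ (bi_rel F) iY iZ iX).
apply: bi_central_proj; rewrite !inE; apply/or3P; apply: Or32; exact: eqxx.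
Qed.

Lemma bi_muC x : bi_mu F * x = x * bi_mu F.
Proof.
rewrite -[bi_mu F](@pres_proj_anticomm _ _ (bi_rel F) iZ iX iY).
apply: bi_central_proj; rewrite !inE; apply/or3P; apply: Or33; exact: eqxx.
Qed.

Lemma bi_filtration :
    (maxn wZ wk <= wX + wY)%N -> (maxn wX wl <= wY + wZ)%N ->
    (maxn wY wm <= wZ + wX)%N ->
  nat_filtration (BI_n F wX wY wZ wk wl wm).
Proof.
move=> hXY hYZ hZX.
apply: (weight_filtration_filtration bi_kappaC bi_lambdaC bi_muC) => //.
- exact: anticomm_swapr.
- exact: anticomm_swapr.
- exact: anticomm_swapl.
- move=> P PL P1 PM; apply: presented_ind => // i u /PM[PX PY PZ].
  by case: i => -[|[|[|//]]] ilt; rewrite (bool_irrelevance ilt isT).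
Qed.

(** The coefficient of [T] in the value at [(0, 0)] is an [F]-linear functional of [v], so its
    vanishing need only be checked on the spanning monomials. *)
Lemma BI_n_coef (kap lam mu zeta : {poly F}) (f : nat -> nat -> {poly F}) n v :
    (forall i j k r s t,
      (wX * i + wY * j + wZ * k + wk * r + wl * s + wm * t <= n)%N ->
      (zeta ^+ i * kap ^+ r * lam ^+ s * mu ^+ t * f j k)`_1 = 0) ->
    BI_n F wX wY wZ wk wl wm n v ->
  (bi_act kap lam mu zeta v f 0%N 0%N)`_1 = 0.
Proof.
move=> mono0; apply: (@smallest_sub _ _ _
  [set v | (bi_act kap lam mu zeta v f 0%N 0%N)`_1 = 0]%classic).
  apply/subspaceP; have L := bi_act_linear kap lam mu zeta f.
  split=> [|a x y /= x0 y0].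
    have := L (-1) 0 0; rewrite !scaleN1r !addNr => /= ->; exact: coef0.
  by rewrite L [LHS]coefD [X in X + _]coefZ x0 y0 mulr0 addr0.
move=> _ [i [j [k [r [s [t [wn ->]]]]]]] /=.
by rewrite bi_act_monomial mono0.
Qed.

(** * Test functionals and the necessity of the inequalities *)

Definition bi_delta (j0 k0 : nat) (p : {poly F}) : nat -> nat -> {poly F} :=
  fun j k => ((j == j0) && (k == k0))%:R * p.

Lemma coef1_natr (m : nat) : (m%:R : {poly F})`_1 = 0.
Proof. by rewrite -polyC_natr coefC. Qed.

Lemma coefX1_neq0 : ('X : {poly F})`_1 <> 0.
Proof. by rewrite coefX; apply/eqP/oner_neq0. Qed.

Lemma anticommXY_weight : BI_n F wX wY wZ wk wl wm (wX + wY)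
  (anticomm (bi_X F) (bi_Y F)) -> (maxn wZ wk <= wX + wY)%N.
Proof.
move=> H; rewrite geq_max; apply/andP; split; rewrite leqNgt; apply/negP => lt.
(* This choice isolates [Z]: the anticommutator takes the value ['X], while [f] is supported at
   [(0, 1)], reached only by monomials containing [Z], which are too heavy. *)
- have := BI_n_coef (kap := 0) (lam := 0) (mu := 0) (zeta := 0)
    (f := bi_delta 0%N 1%N 'X) _ H.
  rewrite bi_act_anticommXY /bi_delta /= mul1r !mul0r addr0 => E.
  apply: coefX1_neq0; apply: E => i j [|[|k]] r s t wt; try nia.
  by rewrite andbF mul0r mulr0 coef0.
(* This choice isolates [kappa]: for [r = 0] all factors are 0 or 1, so the value is constant and
   has no coefficient of [T]; for [r > 0] the monomial is too heavy. *)
- have := BI_n_coef (kap := 'X) (lam := 0) (mu := 0) (zeta := 0)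
    (f := bi_delta 0%N 0%N 1) _ H.
  rewrite bi_act_anticommXY /bi_delta /= mul0r add0r !mulr1 => E.
  apply: coefX1_neq0; apply: E => i j k [|r] s t wt; last nia.
  by rewrite !expr0n expr0 !mulr1 -!natrM coef1_natr.
Qed.

Lemma anticommYZ_weight : BI_n F wX wY wZ wk wl wm (wY + wZ)
  (anticomm (bi_Y F) (bi_Z F)) -> (maxn wX wl <= wY + wZ)%N.
Proof.
move=> H; rewrite geq_max; apply/andP; split; rewrite leqNgt; apply/negP => lt.
(* The character value [zeta = 'X] detects [X]: without [X] the value is constant, and a monomial
   with [X] is too heavy. *)
- have := BI_n_coef (kap := 0) (lam := 0) (mu := 0) (zeta := 'X)
    (f := bi_delta 0%N 0%N 1) _ H.
  rewrite bi_act_anticommYZ /bi_delta /= mul0r addr0 !mulr1 => E.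
  apply: coefX1_neq0; apply: E => -[|i] j k r s t wt; last nia.
  by rewrite !expr0n expr0 mul1r !mulr1 -!natrM coef1_natr.
- have := BI_n_coef (kap := 0) (lam := 'X) (mu := 0) (zeta := 0)
    (f := bi_delta 0%N 0%N 1) _ H.
  rewrite bi_act_anticommYZ /bi_delta /= mul0r add0r !mulr1 => E.
  apply: coefX1_neq0; apply: E => i j k r [|s] t wt; last nia.
  by rewrite !expr0n expr0 !mulr1 -!natrM coef1_natr.
Qed.

Lemma anticommZX_weight : BI_n F wX wY wZ wk wl wm (wZ + wX)
  (anticomm (bi_Z F) (bi_X F)) -> (maxn wY wm <= wZ + wX)%N.
Proof.
move=> H; rewrite geq_max; apply/andP; split; rewrite leqNgt; apply/negP => lt.
(* The support [(1, 0)] of [f] isolates [Y], since it is reached only by monomials containing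
   [Y]. *)
- have := BI_n_coef (kap := 0) (lam := 0) (mu := 0) (zeta := 0)
    (f := bi_delta 1%N 0%N 'X) _ H.
  rewrite bi_act_anticommZX /bi_delta /= mul1r !mul0r addr0 => E.
  apply: coefX1_neq0; apply: E => i [|[|j]] k r s t wt; try nia.
  by rewrite mul0r mulr0 coef0.
- have := BI_n_coef (kap := 0) (lam := 0) (mu := 'X) (zeta := 0)
    (f := bi_delta 0%N 0%N 1) _ H.
  rewrite bi_act_anticommZX /bi_delta /= mul0r add0r !mulr1 => E.
  apply: coefX1_neq0; apply: E => i j k r s [|t] wt; last nia.
  by rewrite !expr0n expr0 !mulr1 -!natrM coef1_natr.
Qed.

Lemma BI_n_gen : [/\ BI_n F wX wY wZ wk wl wm wX (bi_X F),
  BI_n F wX wY wZ wk wl wm wY (bi_Y F) & BI_n F wX wY wZ wk wl wm wZ (bi_Z F)].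
Proof.
split; apply: sub_gen_smallest.
- exists 1%N, 0%N, 0%N, 0%N, 0%N, 0%N; split; first nia.
  by rewrite !expr0 !mulr1 expr1.
- exists 0%N, 1%N, 0%N, 0%N, 0%N, 0%N; split; first nia.
  by rewrite !expr0 !mulr1 mul1r expr1.
- exists 0%N, 0%N, 1%N, 0%N, 0%N, 0%N; split; first nia.
  by rewrite !expr0 !mulr1 mul1r expr1.
Qed.

Lemma nat_filtration_anticomm (A : algType F) (S : nat -> set A) m n a b :
  nat_filtration S -> S m a -> S n b -> S (m + n)%N (anticomm a b).
Proof.
case=> sub _ _ SM Sa Sb; apply: (subspaceD (sub _)).
  by apply: SM; apply: sub_gen_smallest; exists a => //; exists b.
by rewrite addnC; apply: SM; apply: sub_gen_smallest; exists b => //; exists a.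
Qed.

End Main.

Theorem theorem3p5 (F : fieldType) (hF : 2%N \notin [pchar F])
    (wX wY wZ wk wl wm : nat) :
  nat_filtration (BI_n F wX wY wZ wk wl wm) <->
  [/\ (maxn wZ wk <= wX + wY)%N,
      (maxn wX wl <= wY + wZ)%N
    & (maxn wY wm <= wZ + wX)%N].
Proof.
split=> [filt|[]]; last exact: bi_filtration.
have [genX genY genZ] := BI_n_gen F wX wY wZ wk wl wm.
split.
- exact: anticommXY_weight (nat_filtration_anticomm filt genX genY).
- exact: anticommYZ_weight (nat_filtration_anticomm filt genY genZ).
- exact: anticommZX_weight (nat_filtration_anticomm filt genZ genX).
Qed.
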